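(* Let $\mathfrak g$ be a solvable Lie algebra, and let $\mathcal X:=\mathfrak g^n$, $\mathcal W:=\mathfrak g^r$ with $n,r\ge1$. Consider the dynamics $X^+=f(X,W)$, where $f:\mathcal X\times\mathcal W\to\mathcal X$ is a Lie function with linear part $A:\mathcal X\to\mathcal X$ in the state, such that: (1) $f$ belongs to class-$\mathcal A$; (2) the origin of $\mathcal X$ is the unique equilibrium, i.e. for $X\in\mathcal X$, $f(X,W)=X$ for all $W\in\mathcal W$ if and only if $X=0$; (3) there is a nilpotent ideal $\mathfrak h\subseteq\mathfrak g$ with $\mathfrak h\supseteq[\mathfrak g,\mathfrak g]$ such that $f\big((\mathfrak h^{(i)})^n,\mathcal W\big)\subseteq(\mathfrak h^{(i)})^n$ for every ideal $\mathfrak h^{(i)}$ of the lower central series of $\mathfrak h$. If $A$ is Schur, and $W[k]\to\mathfrak h^r$ as $k\to\infty$, then there exists $\beta>0$ such that if $\|W[k]\|\le\beta$ for all $k\ge0$, then the origin of $\mathcal X$ is globally asymptotically stable.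
   Context: All vector spaces are finite dimensional over $\mathbb F\in\{\mathbb R,\mathbb C\}$. $\mathfrak g$ is a (matrix) Lie algebra with a norm $\|\cdot\|$, and $\mu\in[0,2]$ is a constant with $\|[X,Y]\|\le\mu\|X\|\|Y\|$ for all $X,Y\in\mathfrak g$. Cartesian powers carry the sum norm. A linear map is Schur if its spectral radius $\rho$ is less than $1$. Lower central series of $\mathfrak h$: $\mathfrak h^{(1)}:=\mathfrak h$, $\mathfrak h^{(i+1)}:=[\mathfrak h^{(i)},\mathfrak h]$; $\mathfrak h$ is nilpotent if $\mathfrak h^{(p+1)}=0$ for some finite $p$. $\mathfrak g$ is solvable if its derived series $\mathfrak g_0=\mathfrak g$, $\mathfrak g_{i+1}=[\mathfrak g_i,\mathfrak g_i]$ reaches $0$. System: $X^+=f(X,W)$ means $X[k+1]=f(X[k],W[k])$, $k\ge0$, with state $X=(X_1,\dots,X_n)\in\mathcal X$ and exogenous signal $W=(W_1,\dots,W_r)\in\mathcal W$ that does not depend on $X$. A word $\omega$ of length $|\omega|$ is a nested bracket $[Y_{\omega_1},[Y_{\omega_2},[\dots,Y_{\omega_{|\omega|}}]\cdots]$ with letters $Y_{\omega_j}$ in $\widetilde X\cup\widetilde W$, where $\widetilde X=\{X_1,\dots,X_n\}$ and $\widetilde W=\{W_1,\dots,W_r\}$. A Lie function is a function whose components are (possibly infinite) linear combinations of words in its arguments. It belongs to class-$\mathcal A$ if, for each component with scalar coefficients $c_\omega$, there is a neighbourhood of the origin on which $\sum_\omega\mu^{|\omega|-1}|c_\omega|\|Y_{\omega_1}\|\cdots\|Y_{\omega_{|\omega|}}\|<\infty$.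 Under the stated hypotheses the dynamics are written as $f(X,W)=AX+\sum_\omega c_\omega\otimes\omega$, where $A:\mathcal X\to\mathcal X$ is linear, the sum is over words of length at least $2$, every word has at least one letter in $\widetilde X$, and $c_\omega\in\mathbb F^n$ (with $\mathfrak g^n\cong\mathbb F^n\otimes\mathfrak g$). $W[k]\to\mathfrak h^r$ means that the distance from $W[k]$ to the subspace $\mathfrak h^r$ tends to $0$. Globally asymptotically stable: the origin is Lyapunov stable and $X[k]\to0$ as $k\to\infty$ for every initial condition $X[0]\in\mathcal X$. *)

(* Defs.v *)
From HB Require Import structures.
From mathcomp Require Import all_boot all_order all_algebra.
From mathcomp Require Import complex.
From mathcomp Require Import all_classical all_reals all_analysis.

Set Implicit Arguments.
Unset Strict Implicit.
Unset Printing Implicit Defensive.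

Import Order.TTheory GRing.Theory Num.Theory.
Import numFieldNormedType.Exports.

Local Open Scope classical_set_scope.
Local Open Scope ring_scope.

(* The ground field: the reals ([cplx = false]) or the complex numbers
   ([cplx = true]). *)
Definition ground_field (R : realType) (cplx : bool) : numFieldType :=
  if cplx then R[i] : numFieldType else R : numFieldType.

Definition to_complex (R : realType) (cplx : bool) : ground_field R cplx -> R[i] :=
  if cplx return ground_field R cplx -> R[i] then id else fun x : R => x%:C%C.

(* Modulus, with values in the reals in both cases. *)
Definition modulus (R : realType) (cplx : bool) (a : ground_field R cplx) : R :=
  ComplexField.Normc.normc (to_complex a).

Record vnorm (R : realType) (cplx : bool) (V : vectType (ground_field R cplx)) :=
  VNorm {
    vnorm_fun :> V -> R;
    vnormD : forall x y, vnorm_fun (x + y) <= vnorm_fun x + vnorm_fun y;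
    vnormZ : forall a x, vnorm_fun (a *: x) = modulus a * vnorm_fun x;
    vnorm0_eq0 : forall x, vnorm_fun x = 0 -> x = 0 }.

Definition sum_norm (R : realType) (cplx : bool) (V : vectType (ground_field R cplx))
    (N : vnorm V) (n : nat) (X : {ffun 'I_n -> V}) : R :=
  \sum_j N (X j).

Record lie_bracket (K : fieldType) (g : vectType K) := LieBracket {
  bracket :> g -> g -> g;
  bracket_linl : forall y, linear (bracket^~ y);
  bracket_linr : forall x, linear (bracket x);
  bracket_alt : forall x, bracket x x = 0;
  bracket_jacobi : forall x y z,
    bracket x (bracket y z) + bracket y (bracket z x)
      + bracket z (bracket x y) = 0 }.

Section LieAlgebra.
Variables (K : fieldType) (g : vectType K) (br : lie_bracket g).

(* The span of all [br x y] with x in U and y in V; by bilinearity it is enough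
   to take generators, see [comm_spaceP]. *)
Definition comm_space (U V : {vspace g}) : {vspace g} :=
  <<[seq br x y | x <- vbasis U, y <- vbasis V]>>%VS.

Lemma comm_spaceP (U V Z : {vspace g}) :
  (comm_space U V <= Z)%VS <->
  (forall x y, x \in U -> y \in V -> br x y \in Z).
Proof.
pose lX y := GRing.isLinear.Build _ _ _ _ _ (bracket_linl br y).
pose lY x := GRing.isLinear.Build _ _ _ _ _ (bracket_linr br x).
pose fX y : {linear g -> g} := HB.pack (fun x => br x y) (lX y).
pose fY x : {linear g -> g} := HB.pack (br x) (lY x).
split=> [/span_subvP sZ x y xU yV | sZ]; last first.
  apply/span_subvP => _ /allpairsP[[x y] /= [xU yV ->]].
  by apply: sZ; apply: vbasis_mem.
rewrite (coord_vbasis xU) (coord_vbasis yV).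
rewrite -[br _ _]/(fX _ _) linear_sum; apply: memv_suml => i _.
rewrite linearZ; apply: memvZ => /=.
rewrite -[br _ _]/(fY _ _) linear_sum; apply: memv_suml => j _.
rewrite linearZ; apply: memvZ => /=; apply: sZ.
by apply/allpairsP; exists ((vbasis U)`_i, (vbasis V)`_j); split=> //=;
  apply: mem_nth; rewrite size_tuple.
Qed.

(* Numbered from 0: [lower_central h i] is the ideal h^(i+1) of the usual
   numbering h^(1) = h, h^(i+1) = [h^(i), h]. *)
Fixpoint lower_central (h : {vspace g}) (i : nat) : {vspace g} :=
  if i is j.+1 then comm_space (lower_central h j) h else h.

Fixpoint derived_series (i : nat) : {vspace g} :=
  if i is j.+1 then comm_space (derived_series j) (derived_series j)
  else fullv.

Definition nilpotent_space (h : {vspace g}) : Prop :=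
  exists p, lower_central h p = 0%VS.

Definition solvable_lie : Prop := exists i, derived_series i = 0%VS.

Definition lie_ideal (h : {vspace g}) : Prop :=
  forall x y, y \in h -> br x y \in h.

(* The right-nested bracket [y, [s_0, [s_1, ...]]]. *)
Fixpoint nested_bracket (y : g) (s : seq g) : g :=
  if s is z :: s' then br y (nested_bracket z s') else y.

End LieAlgebra.

(* [inl j] is the state letter X_j and [inr j] the signal letter W_j. *)
Definition letter (n r : nat) : Type := ('I_n + 'I_r)%type.

Definition letter_val (n r : nat) (T : Type)
    (X : {ffun 'I_n -> T}) (W : {ffun 'I_r -> T}) (l : letter n r) : T :=
  match l with inl j => X j | inr j => W j end.

(* Value of the word whose letters are those of [l :: w]. *)
Definition word_val (K : fieldType) (g : vectType K) (br : lie_bracket g)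
    (n r : nat) (X : {ffun 'I_n -> g}) (W : {ffun 'I_r -> g})
    (l : letter n r) (w : seq (letter n r)) : g :=
  nested_bracket br (letter_val X W l) (map (letter_val X W) w).

(* Vector coefficients of a Lie series: [c l w] is the coefficient of the
   (nonempty) word [l :: w]. *)
Definition lie_coef (K : fieldType) (n r : nat) : Type :=
  letter n r -> seq (letter n r) -> 'rV[K]_n.

(* The sum of c_w (x) w over the words w of length at most [L]; c_w (x) w is the
   element of g^n whose i-th component is (c_w)_i w. *)
Definition lie_partial_sum (K : fieldType) (g : vectType K)
    (br : lie_bracket g) (n r : nat) (c : lie_coef K n r) (L : nat)
    (X : {ffun 'I_n -> g}) (W : {ffun 'I_r -> g}) : {ffun 'I_n -> g} :=
  [ffun i => \sum_(m < L) \sum_(l : ('I_n + 'I_r)%type)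
     \sum_(w : m.-tuple ('I_n + 'I_r)%type) c l w 0 i *: word_val br X W l w].

(* [f (X, W) = A X + sum_w c_w (x) w] on the whole of g^n x g^r.  The words
   made of one state letter are excluded from the series since [A] is the
   linear part in the state; words made of signal letters only are allowed.
   The series is summed by increasing word length (the alphabet is finite). *)
Definition lie_function (R : realType) (cplx : bool)
    (g : vectType (ground_field R cplx)) (N : vnorm g) (br : lie_bracket g)
    (n r : nat) (A : 'End({ffun 'I_n -> g})) (c : lie_coef (ground_field R cplx) n r)
    (f : {ffun 'I_n -> g} -> {ffun 'I_r -> g} -> {ffun 'I_n -> g}) : Prop :=
  (forall j, c (inl j) [::] = 0) /\
  (forall X W,
     sum_norm N (A X + lie_partial_sum br c L X W - f X W) @[L --> \oo]
       --> (0 : R)).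

(* Words of length m.+1 contribute
   mu ^ m |c_w| ||Y_(w_1)|| ... ||Y_(w_(m+1))||. *)
Definition class_A (R : realType) (cplx : bool)
    (g : vectType (ground_field R cplx)) (N : vnorm g) (mu : R)
    (n r : nat) (c : lie_coef (ground_field R cplx) n r) : Prop :=
  forall i : 'I_n, exists2 d : R, 0 < d &
    forall (X : {ffun 'I_n -> g}) (W : {ffun 'I_r -> g}),
      sum_norm N X + sum_norm N W < d ->
      (\sum_(0 <= m <oo)
        (\sum_(l : ('I_n + 'I_r)%type) \sum_(w : m.-tuple ('I_n + 'I_r)%type)
          mu ^+ m * modulus (c l w 0 i)
            * (N (letter_val X W l)
               * \prod_(a <- w) N (letter_val X W a)))%:E < +oo)%E.

(* The eigenvalues are the complex ones, also for a real vector space. *)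
Definition spectral_radius (R : realType) (cplx : bool)
    (V : vectType (ground_field R cplx)) (A : 'End(V)) : R :=
  let e := vbasis {:V} in
  let M := map_mx (@to_complex R cplx) (passmx.mxof e e A) in
  sup [set ComplexField.Normc.normc z | z in [set z : R[i] | eigenvalue M z]].

Definition schur (R : realType) (cplx : bool)
    (V : vectType (ground_field R cplx)) (A : 'End(V)) : Prop :=
  spectral_radius A < 1.

Definition in_power (K : fieldType) (g : vectType K) (n : nat)
    (U : {vspace g}) (X : {ffun 'I_n -> g}) : Prop :=
  forall j, X j \in U.

Definition dist_power (R : realType) (cplx : bool)
    (g : vectType (ground_field R cplx)) (N : vnorm g) (n : nat)
    (U : {vspace g}) (X : {ffun 'I_n -> g}) : R :=
  inf [set sum_norm N (X - Y) | Y in [set Y | in_power U Y]].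

Definition trajectory (S T : Type) (f : S -> T -> S) (W : nat -> T)
    (X : nat -> S) : Prop :=
  forall k, X k.+1 = f (X k) (W k).

Definition globally_asymptotically_stable (R : realType) (cplx : bool)
    (g : vectType (ground_field R cplx)) (N : vnorm g) (n r : nat)
    (f : {ffun 'I_n -> g} -> {ffun 'I_r -> g} -> {ffun 'I_n -> g})
    (W : nat -> {ffun 'I_r -> g}) : Prop :=
  (forall e : R, 0 < e -> exists2 d : R, 0 < d &
     forall X, trajectory f W X -> sum_norm N (X 0%N) < d ->
       forall k, sum_norm N (X k) < e) /\
  (forall X, trajectory f W X -> sum_norm N (X k) @[k --> \oo] --> (0 : R)).

(* Main.v *)
From HB Require Import structures.
Require Import Defs.
From mathcomp Require Import all_boot all_order all_algebra.
From mathcomp Require Import complex.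
From mathcomp Require Import all_classical all_reals all_analysis.
From mathcomp Require Import ring lra.
Import Order.TTheory GRing.Theory Num.Theory.
Import numFieldNormedType.Exports.

Local Open Scope classical_set_scope.
Local Open Scope ring_scope.

(** The state is driven into the terms of the decreasing chain of ideals
    g, h, [h, h], ... one after the other, until the last term, which is 0.

    Suppose that the trajectory already approaches I^n, where I is a term of
    the chain, and let I' be the next term.  Write the state as X = Y + U with
    Y in I^n and U small, and the signal as W = Z + D with Z in h^r and D
    small.  Modulo I' every word can be expanded in these pieces.  The bracket
    of an element of I with an element of h falls in I' (for I = g, the bracket
    of any two elements does), so the only words that keep a letter Y keep it
    once, all their other letters being small.  Hence modulo I' the dynamics
    are X |-> A X, plus a term linear in Y with a small coefficient, plus a
    term bounded by U:
      dist(X+, I') <= (q + O(u)) dist(X, I') + O(u)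
    with q < 1, and dist(X, I') tends to 0.  By linearity the estimate is
    uniform in Y: this is why a local convergence hypothesis gives a global
    conclusion.  The estimate on words is [nested_bracket_near], its sum over
    all words is [higher_order_near], and [step_near] and [attract_step] are
    one time step and one step along the chain.

    Three ingredients are used.
    - A norm in which A contracts by a factor q < 1 ([schur_adapted_norm]).  It
      serves for the whole chain: as A preserves I'^n, the distance to I'^n in
      this norm is contracted by the same factor.
    - Class A, evaluated at a point all of whose letters are equal to one
      nonzero vector, makes the total weight of the words of a given length
      grow at most geometrically with the length ([class_A_geometric]).
    - The words in the signal alone add up to f(0, W) = 0; so f(X, W) - A X is
      the sum of the differences of the words at (X, W) and at (0, W), and is
      O(|X| + |W|) |X| near the origin.  For beta small enough, the adapted
      norm then does not increase along a trajectory that starts within beta of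
      the origin, which gives Lyapunov stability ([step_contract]).

    Distances to a subspace are expressed by the relation [near_set], which
    avoids infima: a bound on the distance is a decomposition. *)

Set Implicit Arguments.
Unset Strict Implicit.
Unset Printing Implicit Defensive.

(** * Moduli and norms *)

Section Modulus.
Variables (R : realType) (cplx : bool).
Local Notation K := (ground_field R cplx).
Implicit Types a b : K.

Lemma to_complexD a b : to_complex (a + b) = to_complex a + to_complex b.
Proof. by move: a b; rewrite /to_complex; case: cplx => //= a b; rewrite rmorphD. Qed.

Lemma to_complexM a b : to_complex (a * b) = to_complex a * to_complex b.
Proof. by move: a b; rewrite /to_complex; case: cplx => //= a b; rewrite rmorphM. Qed.

Lemma to_complex0 : to_complex (0 : K) = 0.
Proof. by rewrite /to_complex; case: cplx. Qed.

Lemma to_complex1 : to_complex (1 : K) = 1.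
Proof. by rewrite /to_complex; case: cplx. Qed.

Lemma to_complexN a : to_complex (- a) = - to_complex a.
Proof.
apply: (addrI (to_complex a)).
by rewrite -to_complexD !subrr to_complex0.
Qed.

Lemma to_complex_sum (I : Type) (r : seq I) (F : I -> K) :
  to_complex (\sum_(i <- r) F i) = \sum_(i <- r) to_complex (F i).
Proof. exact: (big_morph _ to_complexD to_complex0). Qed.

Lemma modulus0 : modulus (0 : K) = 0.
Proof. by rewrite /modulus to_complex0 ComplexField.Normc.normc0. Qed.

Lemma modulus1 : modulus (1 : K) = 1.
Proof. by rewrite /modulus to_complex1 ComplexField.Normc.normc1. Qed.

Lemma modulusN a : modulus (- a) = modulus a.
Proof.
rewrite /modulus to_complexN; case: (to_complex a) => x y /=.
by rewrite !sqrrN.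
Qed.

Lemma normc_ge0 (z : R[i]) : 0 <= ComplexField.Normc.normc z.
Proof. by case: z => x y /=; apply: sqrtr_ge0. Qed.

Lemma modulus_ge0 a : 0 <= modulus a. Proof. exact: normc_ge0. Qed.

Lemma modulus_real (t : R) : 0 <= t -> exists a : K, modulus a = t.
Proof.
move=> t0; rewrite /modulus /to_complex; case: cplx.
  by exists t%:C%C => /=; rewrite expr0n addr0 sqrtr_sqr ger0_norm.
by exists t => /=; rewrite expr0n addr0 sqrtr_sqr ger0_norm.
Qed.
End Modulus.

Section VNorm.
Variables (R : realType) (cplx : bool) (V : vectType (ground_field R cplx)).
Variable M : vnorm V.

Lemma vnorm0 : M 0 = 0.
Proof. by rewrite -(scale0r (0 : V)) vnormZ modulus0 mul0r. Qed.

Lemma vnormN x : M (- x) = M x.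
Proof. by rewrite -scaleN1r vnormZ modulusN modulus1 mul1r. Qed.

Lemma vnorm_ge0 x : 0 <= M x.
Proof. by have := vnormD M x (- x); rewrite subrr vnorm0 vnormN; lra. Qed.

Lemma vnorm_sum (I : Type) (r : seq I) (P : pred I) (F : I -> V) :
  M (\sum_(i <- r | P i) F i) <= \sum_(i <- r | P i) M (F i).
Proof.
elim/big_ind2: _ => [|x a y b xa yb|//]; first by rewrite vnorm0.
exact: le_trans (vnormD M _ _) (lerD xa yb).
Qed.
End VNorm.

Section SumNorm.
Variables (R : realType) (cplx : bool) (V : vectType (ground_field R cplx)).
Variables (M : vnorm V) (n : nat).
Implicit Types X Y : {ffun 'I_n -> V}.

Lemma sum_normD X Y : sum_norm M (X + Y) <= sum_norm M X + sum_norm M Y.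
Proof.
rewrite /sum_norm -big_split /=; apply: ler_sum => j _.
by rewrite ffunE; apply: vnormD.
Qed.

Lemma sum_normZ a X : sum_norm M (a *: X) = modulus a * sum_norm M X.
Proof.
rewrite /sum_norm mulr_sumr; apply: eq_bigr => j _.
by rewrite ffunE vnormZ.
Qed.

Lemma sum_norm_ge j X : M (X j) <= sum_norm M X.
Proof.
rewrite /sum_norm (bigD1 j) //= lerDl.
by apply: sumr_ge0 => i _; apply: vnorm_ge0.
Qed.

Lemma sum_norm0_eq0 X : sum_norm M X = 0 -> X = 0.
Proof.
move=> X0; apply/ffunP => j; rewrite ffunE; apply: (vnorm0_eq0 (v := M)).
by apply/eqP; rewrite eq_le vnorm_ge0 -X0 sum_norm_ge.
Qed.

(** As a [vnorm], so that the norm of the powers of g and the adapted norm are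
    treated alike. *)
Definition sum_vnorm : vnorm {ffun 'I_n -> V} :=
  VNorm sum_normD sum_normZ sum_norm0_eq0.
End SumNorm.

(** * Contracting norms for complex matrices *)

Section AdaptedMatrix.
Variables (R : realType) (d : nat).
Local Notation C := (R[i]).
Local Notation normc := (@ComplexField.Normc.normc R).
Implicit Types (z : 'rV[C]_d) (M B : 'M[C]_d) (s : seq C).

Definition l1norm z : R := \sum_j normc (z 0 j).

Lemma l1normD z z' : l1norm (z + z') <= l1norm z + l1norm z'.
Proof.
rewrite /l1norm -big_split /=; apply: ler_sum => j _.
by rewrite mxE; apply: le_normcD.
Qed.

Lemma l1normZ (a : C) z : l1norm (a *: z) = normc a * l1norm z.
Proof.
rewrite /l1norm mulr_sumr; apply: eq_bigr => j _.
by rewrite mxE ComplexField.Normc.normcM.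
Qed.

Lemma l1norm0 : l1norm 0 = 0.
Proof. by rewrite -(scale0r 0) l1normZ ComplexField.Normc.normc0 mul0r. Qed.

Lemma l1norm_ge0 z : 0 <= l1norm z.
Proof. by apply: sumr_ge0 => j _; apply: normc_ge0. Qed.

Lemma entry_le_l1norm z i : normc (z 0 i) <= l1norm z.
Proof.
rewrite /l1norm (bigD1 i) // lerDl.
by apply: sumr_ge0 => j _; apply: normc_ge0.
Qed.

Lemma normc_sum (I : Type) (r : seq I) (F : I -> C) :
  normc (\sum_(i <- r) F i) <= \sum_(i <- r) normc (F i).
Proof.
elim/big_ind2: _ => [|x a y b xa yb|//]; first by rewrite ComplexField.Normc.normc0.
exact: le_trans (le_normcD _ _) (lerD xa yb).
Qed.

Lemma l1norm_mulmx B :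
  exists2 c : R, 0 <= c & forall z, l1norm (z *m B) <= c * l1norm z.
Proof.
exists (\sum_i \sum_j normc (B i j)).
  by apply: sumr_ge0 => i _; apply: sumr_ge0 => j _; apply: normc_ge0.
move=> z; rewrite mulrC.
apply: (@le_trans _ _ (\sum_j \sum_i normc (z 0 i) * normc (B i j))).
  apply: ler_sum => j _; rewrite mxE; apply: le_trans (normc_sum _ _) _.
  by apply: ler_sum => i _; rewrite ComplexField.Normc.normcM.
rewrite exchange_big mulr_sumr; apply: ler_sum => i _ /=; rewrite -mulr_sumr.
rewrite ler_wpM2r //; first by apply: sumr_ge0 => j _; apply: normc_ge0.
exact: entry_le_l1norm.
Qed.

Definition shift_mx M (l : C) : 'M[C]_d := M - l%:M.

(** If the scalars of s are the eigenvalues of M with multiplicity, then, by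
    Cayley-Hamilton, the vectors z, z (M - l_1), z (M - l_1) (M - l_2), ... end
    with 0.  Along this chain M acts as a triangular matrix with the eigenvalues
    on the diagonal and ones next to it; weighting the i-th vector by t ^ i with
    t large makes the off-diagonal part negligible. *)
Fixpoint chain_norm M (t : R) s z : R :=
  if s is l :: s' then l1norm z + t * chain_norm M t s' (z *m shift_mx M l) else 0.

Fixpoint chain_end M s z : 'rV[C]_d :=
  if s is l :: s' then chain_end M s' (z *m shift_mx M l) else z.

Lemma chain_normD M t s z z' : 0 <= t ->
  chain_norm M t s (z + z') <= chain_norm M t s z + chain_norm M t s z'.
Proof.
move=> t0; elim: s z z' => [|l s IHs] z z' /=; first by rewrite addr0.
rewrite mulmxDl addrACA -mulrDr lerD ?l1normD //.
by rewrite ler_wpM2l // IHs.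
Qed.

Lemma chain_normZ M t s a z :
  chain_norm M t s (a *: z) = normc a * chain_norm M t s z.
Proof.
elim: s z => [|l s IHs] z /=; first by rewrite mulr0.
by rewrite -scalemxAl IHs l1normZ; ring.
Qed.

Lemma chain_norm_ge0 M t s z : 0 <= t -> 0 <= chain_norm M t s z.
Proof.
move=> t0; elim: s z => [|l s IHs] z //=.
by rewrite addr_ge0 ?l1norm_ge0 // mulr_ge0.
Qed.

Lemma chain_norm_ge_l1 M t s z : 0 <= t -> chain_end M s z = 0 ->
  l1norm z <= chain_norm M t s z.
Proof.
case: s => [|l s] t0 /= zs; first by rewrite zs l1norm0.
by rewrite lerDl mulr_ge0 // chain_norm_ge0.
Qed.

Lemma chain_norm_le_l1 M t s : 0 <= t ->
  exists2 c : R, 0 <= c & forall z, chain_norm M t s z <= c * l1norm z.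
Proof.
move=> t0; elim: s => [|l s [c c0 IHs]] /=; first by exists 0 => // z; rewrite mul0r.
have [b b0 Hb] := l1norm_mulmx (shift_mx M l).
exists (1 + t * (c * b)) => [|z]; first by rewrite addr_ge0 // !mulr_ge0.
rewrite mulrDl mul1r lerD2l -mulrA ler_wpM2l //.
apply: le_trans (IHs _) _; rewrite -mulrA ler_wpM2l //.
Qed.

(** Each vector of the chain is mapped by M to l times itself plus the next
    one, which costs a factor 1 / t against its weight.  The first vector is
    nobody's successor: subtracting it makes the induction go through. *)
Lemma chain_norm_mulmx M t s (q : R) z : 0 < t ->
  (forall l, l \in s -> normc l <= q) -> chain_end M s z = 0 ->
  chain_norm M t s (z *m M) <=
    q * chain_norm M t s z + (chain_norm M t s z - l1norm z) / t.
Proof.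
move=> t0; elim: s z => [|l s IHs] z /= sq zs.
  by rewrite zs l1norm0 mulr0 subrr mul0r addr0.
set z1 := z *m shift_mx M l.
have zM : z *m M = z1 + l *: z by rewrite /z1 /shift_mx mulmxBr mul_mx_scalar subrK.
have -> : z *m M *m shift_mx M l = z1 *m M.
  by rewrite /z1 /shift_mx -!mulmxA mulmxBl mulmxBr scalar_mxC.
have lq : normc l <= q by apply: sq; rewrite mem_head.
have sq' l' : l' \in s -> normc l' <= q.
  by move=> ls; apply: sq; rewrite in_cons ls orbT.
have IH := IHs z1 sq' zs.
have H1 : l1norm (z *m M) <= l1norm z1 + q * l1norm z.
  rewrite zM; apply: le_trans (l1normD _ _) _; rewrite lerD2l l1normZ.
  by rewrite ler_wpM2r ?l1norm_ge0.
have H2 : t * chain_norm M t s (z1 *m M) <=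
          t * (q * chain_norm M t s z1) + (chain_norm M t s z1 - l1norm z1).
  apply: le_trans (ler_wpM2l (ltW t0) IH) _.
  by rewrite mulrDr [X in _ + X]mulrC divfK // gt_eqF.
(* chain_norm (l :: s) z - l1norm z is t * chain_norm s z1. *)
rewrite addrAC subrr add0r [t * _ / t]mulrAC divff ?gt_eqF // mul1r.
apply: le_trans (lerD H1 H2) _.
by rewrite le_eqVlt; apply/orP; left; apply/eqP; ring.
Qed.
End AdaptedMatrix.

Lemma chain_end_eigenvalues (R : realType) (d : nat) (M : 'M[R[i]]_d) :
  exists2 s : seq R[i], (forall l, l \in s -> eigenvalue M l) &
    forall z, chain_end M s z = 0.
Proof.
case: d M => [|d] M; first by exists [::] => // z; rewrite thinmx0.
have [s] := closed_field_poly_normal (char_poly M).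
have /monicP -> := char_poly_monic M; rewrite scale1r => Ms; exists s => [l ls|z].
  by rewrite eigenvalue_root_char Ms root_prod_XsubC.
have endE s' : chain_end M s' z = z *m horner_mx M (\prod_(l <- s') ('X - l%:P)).
  elim: s' z => [|l s' IH] z' /=; first by rewrite big_nil rmorph1 mulmx1.
  rewrite big_cons rmorphM IH mulmxA; congr (_ *m _ *m _).
  by rewrite rmorphB /= horner_mx_X horner_mx_C.
by rewrite endE -Ms Cayley_Hamilton mulmx0.
Qed.

(** * Equivalence of norms *)

Lemma entry_le_mx_norm (R : realType) (D : nat) (x : 'rV[R]_D) i : `|x 0 i| <= `|x|.
Proof.
rewrite [leRHS]mx_normrE.
exact: (le_bigmax_cond _ (fun ij : 'I_1 * 'I_D => `|x ij.1 ij.2|) (j := (0, i))).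
Qed.

(** All norms on a real space of finite dimension dominate the sup norm: F is
    continuous, hence has a positive minimum on the compact unit sphere. *)
Lemma entry_bound_real_norm (R : realType) (D : nat) (F : 'rV[R]_D -> R) :
  (forall x y, F (x + y) <= F x + F y) ->
  (forall a x, F (a *: x) = `|a| * F x) ->
  (forall x, F x = 0 -> x = 0) ->
  exists2 c : R, 0 <= c & forall (x : 'rV[R]_D) i, `|x 0 i| <= c * F x.
Proof.
move=> FD FZ F0.
have F00 : F 0 = 0 by rewrite -(scale0r 0) FZ normr0 mul0r.
have FN x : F (- x) = F x by rewrite -scaleN1r FZ normrN1 mul1r.
have Fge0 x : 0 <= F x by have := FD x (- x); rewrite subrr F00 FN; lra.
pose B := \sum_i F (delta_mx 0 i).
have FB x : F x <= `|x| * B.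
  rewrite {1}(row_sum_delta x) /B mulr_sumr.
  apply: (@le_trans _ _ (\sum_i F (x 0 i *: delta_mx 0 i))).
    elim/big_ind2: _ => [|x1 a y b xa yb|//]; first by rewrite F00.
    exact: le_trans (FD _ _) (lerD xa yb).
  by apply: ler_sum => i _; rewrite FZ ler_wpM2r // entry_le_mx_norm.
have B0 : 0 <= B by apply: sumr_ge0.
have Flip x y : `|F x - F y| <= F (x - y).
  rewrite ler_norml; apply/andP; split.
    by have := FD x (y - x); rewrite addrC subrK -(opprB x y) FN; lra.
  by have := FD y (x - y); rewrite addrC subrK; lra.
have Fcont : continuous F.
  move=> x; apply/(cvgrPdist_lt (FF := nbhs_filter x)) => e e0.
  have eB : 0 < e / (B + 1) by rewrite divr_gt0 // ltr_wpDl.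
  near=> y; apply: le_lt_trans (Flip _ _) _; apply: le_lt_trans (FB _) _.
  apply: (@le_lt_trans _ _ (`|x - y| * (B + 1))).
    by rewrite ler_wpM2l // lerDl.
  rewrite -ltr_pdivlMr; last by rewrite ltr_wpDl.
  near: y; apply: filterS (nbhsx_ballx x _ eB) => y.
  by rewrite mx_norm_ball.
(* The sphere is empty in dimension 0. *)
pose S : set 'rV[R]_D := [set x | `|x| = 1].
have normS x : x != 0 -> S (`|x|^-1 *: x).
  move=> x0; rewrite /S /= mx_normZ normfV normr_id mulVf //.
  by rewrite normr_eq0.
have [Sne|Sem] := pselect (S !=set0); last first.
  exists 0 => // x i; have [->|x0] := eqVneq x 0.
    by rewrite mxE normr0 mul0r.
  by exfalso; apply: Sem; exists (`|x|^-1 *: x); apply: normS.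
have Scomp : compact S.
  apply: bounded_closed_compact.
    exists 1; split => // M M1 x /= ->; exact: ltW.
  apply: (@preimage_closed _ _ (fun x : 'rV[R]_D => `|x|) [set 1]).
    by move=> x _; apply: norm_continuous.
  exact: closed_eq.
have [m mS mmin] := compact_EVT_min Sne Scomp (continuous_subspaceT Fcont).
have m1 : `|m| = 1 by move/set_mem: mS.
have m0 : 0 < F m.
  rewrite lt_neqAle Fge0 andbT; apply/eqP => /esym /F0 m0.
  by move: m1; rewrite m0 normr0 => /esym/eqP; rewrite oner_eq0.
exists (F m)^-1 => [|x i]; first by rewrite invr_ge0 ltW.
apply: le_trans (entry_le_mx_norm _ _) _.
have [->|x0] := eqVneq x 0; first by rewrite normr0 F00 mulr0.
rewrite ler_pdivlMl //; have := mmin _ (mem_set (normS _ x0)).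
by rewrite FZ normfV normr_id ler_pdivlMl ?normr_gt0 // mulrC.
Unshelve. all: by end_near. Qed.

Section CoordBound.
Variables (R : realType) (cplx : bool) (V : vectType (ground_field R cplx)).
Local Notation K := (ground_field R cplx).
Local Notation e := (vbasis (@fullv K V)).
Local Notation d := (\dim (@fullv K V)).

Definition complex_coords (x : V) : 'rV[R[i]]_d :=
  map_mx (@to_complex R cplx) (passmx.rVof e x).

Let e_basis : basis_of fullv e := vbasisP fullv.

Lemma complex_coordsD x y :
  complex_coords (x + y) = complex_coords x + complex_coords y.
Proof. by apply/rowP => j; rewrite !mxE linearD to_complexD. Qed.

Lemma complex_coordsZ a x :
  complex_coords (a *: x) = to_complex a *: complex_coords x.
Proof. by apply/rowP => j; rewrite !mxE linearZ /= to_complexM. Qed.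

Lemma complex_coords_app (A : 'End(V)) x :
  complex_coords (A x) =
    complex_coords x *m map_mx (@to_complex R cplx) (passmx.mxof e e A).
Proof.
rewrite /complex_coords (passmx.rVof_app _ e_basis).
apply/rowP => j; rewrite !mxE to_complex_sum; apply: eq_bigr => i _.
by rewrite to_complexM !mxE.
Qed.

Lemma vnorm_le_coords (M : vnorm V) :
  exists2 c : R, 0 <= c & forall x, M x <= c * l1norm (complex_coords x).
Proof.
exists (\sum_(i < d) M (e`_i)); first by apply: sumr_ge0 => i _; apply: vnorm_ge0.
move=> x; rewrite -{1}(passmx.rVofK e_basis x) /passmx.vecof mulrC mulr_sumr.
apply: le_trans (vnorm_sum _ _ _ _) _; apply: ler_sum => i _.
rewrite vnormZ ler_wpM2r ?vnorm_ge0 //.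
by apply: le_trans (entry_le_l1norm _ i); rewrite !mxE.
Qed.

Lemma vecofD (u v : 'rV[K]_d) :
  passmx.vecof e (u + v) = passmx.vecof e u + passmx.vecof e v.
Proof.
rewrite /passmx.vecof -big_split; apply: eq_bigr => i _.
by rewrite mxE scalerDl.
Qed.

Lemma vecofZ a (u : 'rV[K]_d) : passmx.vecof e (a *: u) = a *: passmx.vecof e u.
Proof.
rewrite /passmx.vecof scaler_sumr; apply: eq_bigr => i _.
by rewrite mxE scalerA.
Qed.

(** Reduces the comparison to a real norm: j identifies a space of real vectors
    with the space of coordinates over the ground field. *)
Lemma coords_le_vnorm_of (D : nat) (j : 'rV[R]_D -> 'rV[K]_d) (M : vnorm V) :
  (forall x y, j (x + y) = j x + j y) ->
  (forall a x, exists2 b : K, modulus b = `|a| & j (a *: x) = b *: j x) ->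
  (forall x, j x = 0 -> x = 0) ->
  (forall v, exists x, j x = v) ->
  (forall x i, modulus (j x 0 i) <= \sum_k `|x 0 k|) ->
  exists2 c : R, 0 <= c & forall x, l1norm (complex_coords x) <= c * M x.
Proof.
move=> jD jZ j0 jS jB; pose F x := M (passmx.vecof e (j x)).
have [|||c c0 Fc] := @entry_bound_real_norm R D F.
- by move=> x y; rewrite /F jD vecofD; apply: vnormD.
- move=> a x; rewrite /F; have [b <- ->] := jZ a x.
  by rewrite vecofZ vnormZ.
- move=> x /vnorm0_eq0 /eqP.
  by rewrite (passmx.vecof_eq0 e_basis) => /eqP /j0.
exists (\sum_(i < d) \sum_(k < D) c) => [|x].
  by apply: sumr_ge0 => i _; apply: sumr_ge0.
have [v vx] := jS (passmx.rVof e x).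
rewrite /l1norm mulr_suml; apply: ler_sum => i _; rewrite mxE -/(modulus _) -vx.
apply: le_trans (jB _ _) _; rewrite mulr_suml; apply: ler_sum => k _.
apply: le_trans (Fc _ _) _; rewrite /F vx.
by rewrite (passmx.rVofK e_basis).
Qed.
End CoordBound.

Lemma coords_le_vnorm (R : realType) (cplx : bool)
    (V : vectType (ground_field R cplx)) (M : vnorm V) :
  exists2 c : R, 0 <= c & forall x, l1norm (complex_coords x) <= c * M x.
Proof.
case: cplx V M => V M; set d := \dim (@fullv _ V).
- pose j (x : 'rV[R]_(d + d)) : 'rV[R[i]]_d :=
    \row_i (x 0 (lshift d i) +i* x 0 (rshift d i))%C.
  apply: (@coords_le_vnorm_of _ true V _ j).
  + by move=> x y; apply/rowP => i; rewrite !mxE.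
  + move=> a x; exists a%:C%C.
      by rewrite /modulus /= expr0n addr0 sqrtr_sqr.
    apply/rowP => i; rewrite !mxE; apply/eqP.
    by rewrite eq_complex /= !mul0r subr0 addr0 !eqxx.
  + move=> x x0; apply/rowP => i; rewrite mxE.
    case: (split_ordP i) => k ->.
      by move/rowP/(_ k): x0; rewrite !mxE => -[].
    by move/rowP/(_ k): x0; rewrite !mxE => -[].
  + move=> v; exists (row_mx (map_mx (@complex.Re R) v) (map_mx (@complex.Im R) v)).
    apply/rowP => i; rewrite mxE row_mxEl row_mxEr !mxE.
    by case: (v 0 i).
  + move=> x i; rewrite mxE /modulus /=.
    rewrite big_split_ord /=; set a := x 0 _; set b := x 0 _.
    apply: (@le_trans _ _ (`|a| + `|b|)).
      rewrite -[leRHS]ger0_norm ?addr_ge0 // -sqrtr_sqr ler_wsqrtr //.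
      rewrite sqrrD !real_normK ?num_real //.
      by rewrite lerD2r lerDl mulrn_wge0 // mulr_ge0.
    by apply: lerD; rewrite (bigD1 i) //= lerDl; apply: sumr_ge0.
- apply: (@coords_le_vnorm_of _ false V d id).
  + by [].
  + move=> a x; exists a => //.
    by rewrite /modulus /= expr0n addr0 sqrtr_sqr.
  + by [].
  + by move=> v; exists v.
  + move=> x i; rewrite /modulus /= expr0n addr0 sqrtr_sqr (bigD1 i) //=.
    by rewrite lerDl; apply: sumr_ge0.
Qed.

Lemma schur_eigenvalue_lt1 (R : realType) (cplx : bool)
    (V : vectType (ground_field R cplx)) (A : 'End(V)) (z : R[i]) :
  schur A ->
  eigenvalue (map_mx (@to_complex R cplx)
                (passmx.mxof (vbasis fullv) (vbasis fullv) A)) z ->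
  ComplexField.Normc.normc z < 1.
Proof.
rewrite /schur /spectral_radius; set M := map_mx _ _ => A1 Mz.
apply: le_lt_trans A1; apply: sup_upper_bound; last by exists z.
split; first by exists (ComplexField.Normc.normc z); exists z.
have [s] := closed_field_poly_normal (char_poly M).
have /monicP -> := char_poly_monic M; rewrite scale1r => Ms.
exists (\sum_(l <- s) ComplexField.Normc.normc l) => _ [l /= Ml <-].
move: Ml; rewrite eigenvalue_root_char Ms root_prod_XsubC => ls.
rewrite (big_rem _ ls) /= lerDl.
by apply: sumr_ge0 => k _; apply: normc_ge0.
Qed.

Lemma seq_norm_bound_lt1 (R : realType) (s : seq R[i]) :
  (forall l, l \in s -> ComplexField.Normc.normc l < 1) ->
  exists2 q : R, 0 <= q < 1 &
    forall l, l \in s -> ComplexField.Normc.normc l <= q.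
Proof.
elim: s => [|l s IHs] s1; first by exists 0; rewrite ?lexx ?ltr01.
have [l' ls|q /andP[q0 q1] sq] := IHs; first by apply: s1; rewrite in_cons ls orbT.
have l1 := s1 _ (mem_head _ _).
exists (Num.max q (ComplexField.Normc.normc l)).
  by rewrite le_max q0 gt_max q1 l1.
move=> l'; rewrite in_cons => /orP[/eqP ->|/sq ql]; rewrite le_max ?lexx ?orbT //.
by rewrite ql.
Qed.

(** The norm is the chain norm of the coordinates, rescaled to dominate M. *)
Lemma schur_adapted_norm (R : realType) (cplx : bool)
    (V : vectType (ground_field R cplx)) (A : 'End(V)) (M : vnorm V) :
  schur A ->
  exists (P : vnorm V) (q kappa : R), [/\ 0 <= q < 1, 0 < kappa,
    forall x, P (A x) <= q * P x,
    forall x, M x <= P x & forall x, P x <= kappa * M x].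
Proof.
move=> A1; pose MA := map_mx (@to_complex R cplx)
  (passmx.mxof (vbasis (@fullv _ V)) (vbasis fullv) A).
have [s sM s0] := chain_end_eigenvalues MA.
have [l /sM /schur_eigenvalue_lt1 ->//|q0 /andP[q00 q01] sq] :=
  @seq_norm_bound_lt1 _ s.
(* t is chosen for q0 + 1 / t to be the midpoint q of q0 and 1. *)
pose t := 2 / (1 - q0); pose q := (1 + q0) / 2.
have t0 : 0 < t by rewrite divr_gt0 // subr_gt0.
have t1 : q0 + t^-1 = q by rewrite /t /q; field; rewrite gt_eqF // subr_gt0.
have [c c0 Mc] := vnorm_le_coords M.
have [c' c'0 Mc'] := coords_le_vnorm M.
have [b b0 sb] := chain_norm_le_l1 MA s (ltW t0).
pose P (x : V) := (c + 1) * chain_norm MA t s (complex_coords x).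
have MP x : M x <= P x.
  apply: le_trans (Mc x) _; rewrite /P.
  apply: ler_pM => //; first exact: l1norm_ge0.
    by rewrite lerDl.
  exact: chain_norm_ge_l1 (ltW t0) (s0 _).
have c1 : 0 <= c + 1 by rewrite addr_ge0.
have PD x y : P (x + y) <= P x + P y.
  by rewrite /P -mulrDr ler_wpM2l // complex_coordsD chain_normD // ltW.
have PZ a x : P (a *: x) = modulus a * P x.
  by rewrite /P complex_coordsZ chain_normZ -/(modulus a) mulrCA.
have P0 x : P x = 0 -> x = 0.
  move=> x0; apply: (vnorm0_eq0 (v := M)); apply/eqP.
  by rewrite eq_le vnorm_ge0 -x0 MP.
exists (VNorm PD PZ P0), q, ((c + 1) * (b * c') + 1); split=> /=.
- by rewrite /q; apply/andP; split; lra.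
- by rewrite ltr_wpDl // !mulr_ge0.
- move=> x; rewrite /P mulrCA ler_wpM2l // complex_coords_app -/MA.
  apply: le_trans (chain_norm_mulmx t0 sq (s0 _)) _.
  rewrite -t1 [leRHS]mulrDl lerD2l mulrC.
  apply: ler_wpM2l; first by rewrite invr_ge0 ltW.
  by rewrite lerBlDr lerDl l1norm_ge0.
- by [].
- move=> x; rewrite mulrDl mul1r -mulrA.
  apply: (@le_trans _ _ ((c + 1) * (b * c' * M x))); last by rewrite lerDl vnorm_ge0.
  rewrite /P ler_wpM2l //; apply: le_trans (sb _) _.
  by rewrite -mulrA ler_wpM2l.
Qed.

(** * Vectors near a set, and words modulo an ideal *)

Section Near.
Variables (R : realType) (cplx : bool) (V : vectType (ground_field R cplx)).
Variables (M : vnorm V).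
Implicit Types (S : V -> Prop) (a b : R) (x y : V).

Definition near_set S a x := exists2 s, S s & M (x - s) <= a.

Lemma near_set_mono S a b x : a <= b -> near_set S a x -> near_set S b x.
Proof. by move=> ab [s Ss xs]; exists s => //; apply: le_trans ab. Qed.

Lemma near_set_ge0 S a x : near_set S a x -> 0 <= a.
Proof. by case=> s _; apply: le_trans; apply: vnorm_ge0. Qed.

Lemma near_set_norm S x : S 0 -> near_set S (M x) x.
Proof. by move=> S0; exists 0; rewrite ?subr0. Qed.

Lemma near_set_mem S x : S x -> near_set S 0 x.
Proof. by move=> Sx; exists x; rewrite ?subrr ?vnorm0. Qed.

Lemma near_setD S a b x y : (forall s t, S s -> S t -> S (s + t)) ->
  near_set S a x -> near_set S b y -> near_set S (a + b) (x + y).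
Proof.
move=> SD [s Ss xs] [t St yt]; exists (s + t); first exact: SD.
by rewrite opprD addrACA; apply: le_trans (vnormD _ _ _) (lerD xs yt).
Qed.

Lemma near_setZ S (k : ground_field R cplx) a x : (forall s, S s -> S (k *: s)) ->
  near_set S a x -> near_set S (modulus k * a) (k *: x).
Proof.
move=> SZ [s Ss xs]; exists (k *: s); first exact: SZ.
by rewrite -scalerBr vnormZ ler_wpM2l // modulus_ge0.
Qed.

Lemma near_set_sum S (I : Type) (r : seq I) (a : I -> R) (x : I -> V) :
  S 0 -> (forall s t, S s -> S t -> S (s + t)) ->
  (forall i, near_set S (a i) (x i)) ->
  near_set S (\sum_(i <- r) a i) (\sum_(i <- r) x i).
Proof.
move=> S0 SD ax; elim/big_ind2: _ => // [|x1 a1 x2 a2]; first exact: near_set_mem.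
exact: near_setD.
Qed.
End Near.

Section InPower.
Variables (K : fieldType) (g : vectType K) (n : nat) (U : {vspace g}).
Implicit Types X Y : {ffun 'I_n -> g}.

Lemma in_power0 : in_power U (0 : {ffun 'I_n -> g}).
Proof. by move=> j; rewrite ffunE mem0v. Qed.

Lemma in_powerD X Y : in_power U X -> in_power U Y -> in_power U (X + Y).
Proof. by move=> XU YU j; rewrite ffunE memvD. Qed.

Lemma in_powerB X Y : in_power U X -> in_power U Y -> in_power U (X - Y).
Proof. by move=> XU YU j; rewrite !ffunE memvB. Qed.
End InPower.

Lemma near_power (R : realType) (cplx : bool) (g : vectType (ground_field R cplx))
    (N : vnorm g) (n : nat) (U : {vspace g}) (a : 'I_n -> R) (X : {ffun 'I_n -> g}) :
  (forall i, near_set N (fun x => x \in U) (a i) (X i)) ->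
  near_set (sum_vnorm N n) (in_power U) (\sum_i a i) X.
Proof.
move=> Xa; have /choice[s sP] i : exists s, s \in U /\ N (X i - s) <= a i.
  by have [s sU sX] := Xa i; exists s.
exists [ffun i => s i] => [j|]; first by rewrite ffunE; case: (sP j).
by apply: ler_sum => i _; rewrite !ffunE; case: (sP i).
Qed.

Section Bracket.
Variables (K : fieldType) (g : vectType K) (br : lie_bracket g).
Implicit Types (x y z : g) (U V I J : {vspace g}).

Lemma br_linP x : {f : {linear g -> g} | f =1 br x}.
Proof.
pose lX := GRing.isLinear.Build _ _ _ _ _ (bracket_linr br x).
by pose f : {linear g -> g} := HB.pack (bracket br x) lX; exists f.
Qed.

Lemma brDr x y z : br x (y + z) = br x y + br x z.
Proof. by have [f fE] := br_linP x; rewrite -!fE linearD. Qed.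

Lemma brNr x y : br x (- y) = - br x y.
Proof. by have [f fE] := br_linP x; rewrite -!fE linearN. Qed.

Lemma br0r x : br x 0 = 0.
Proof. by have [f fE] := br_linP x; rewrite -!fE linear0. Qed.

Lemma brDl x y z : br (x + y) z = br x z + br y z.
Proof. by have := bracket_linl br z 1 x y; rewrite !scale1r. Qed.

Lemma brNC x y : br y x = - br x y.
Proof.
have := bracket_alt br (x + y); rewrite brDl !brDr !bracket_alt add0r addr0.
by move=> /eqP; rewrite addrC addr_eq0 => /eqP.
Qed.

Lemma br_diff x y z t : br x z - br y t = br (x - y) z + br y (z - t).
Proof.
by rewrite brDl brDr brNr [br (- y) z]brNC brNr -(brNC z y) addrA subrK.
Qed.

Lemma br_derivation x y z : br x (br y z) = br (br x y) z + br y (br x z).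
Proof.
have /eqP := bracket_jacobi br x y z; rewrite -addrA addr_eq0 => /eqP ->.
by rewrite opprD addrC -(brNC z (br x y)) -brNr -(brNC z x).
Qed.

Lemma lie_idealr I x y : lie_ideal br I -> x \in I -> br x y \in I.
Proof. by move=> Iid xI; rewrite brNC memvN; apply: Iid. Qed.

Lemma lie_ideal0 : lie_ideal br 0.
Proof. by move=> x y; rewrite !memv0 => /eqP ->; rewrite br0r. Qed.

Lemma lie_idealf : lie_ideal br fullv.
Proof. by move=> x y _; rewrite memvf. Qed.

Lemma mem_comm_space U V x y : x \in U -> y \in V -> br x y \in comm_space br U V.
Proof.
have [/(_ (subvv _)) H _] := comm_spaceP br U V (comm_space br U V).
exact: H.
Qed.

(** [br x] is a derivation. *)
Lemma lie_ideal_comm_space U V :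
  lie_ideal br U -> lie_ideal br V -> lie_ideal br (comm_space br U V).
Proof.
move=> Uid Vid x y; have [f fE] := br_linP x.
suff: (comm_space br U V <= linfun f @^-1: comm_space br U V)%VS.
  by move=> /subvP /[apply]; rewrite -memv_preim lfunE /= fE.
apply/comm_spaceP => u v uU vV; rewrite -memv_preim lfunE /= fE br_derivation.
by apply: memvD; apply: mem_comm_space => //; [apply: Uid | apply: Vid].
Qed.

Lemma lie_ideal_lower_central U i :
  lie_ideal br U -> lie_ideal br (lower_central br U i).
Proof. by move=> Uid; elim: i => //= i IHi; apply: lie_ideal_comm_space. Qed.

Lemma nested_bracket_mem (T : Type) I (Y Z : T -> g) l w : lie_ideal br I ->
  (forall l, Y l - Z l \in I) ->
  nested_bracket br (Y l) (map Y w) - nested_bracket br (Z l) (map Z w) \in I.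
Proof.
move=> Iid YZ; elim: w l => [|k w IHw] l //=.
set a := nested_bracket br (Y k) _; set b := nested_bracket br (Z k) _.
rewrite br_diff.
by apply: memvD; [apply: lie_idealr | apply: Iid; apply: IHw].
Qed.
End Bracket.

Section WordDifference.
Variables (R : realType) (cplx : bool) (g : vectType (ground_field R cplx)).
Variables (br : lie_bracket g) (N : vnorm g) (mu : R).
Hypothesis mu_ge0 : 0 <= mu.
Hypothesis br_bound : forall x y : g, N (br x y) <= mu * N x * N y.

Lemma nested_bracket_norm (T : Type) (P : T -> g) (u : R) l w :
  (forall l, N (P l) <= u) ->
  N (nested_bracket br (P l) (map P w)) <= mu ^+ size w * u ^+ (size w).+1.
Proof.
move=> Pu; have u0 : 0 <= u by apply: le_trans (Pu l); apply: vnorm_ge0.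
elim: w l => [|k w IHw] l /=; first by rewrite mul1r.
apply: le_trans (br_bound _ _) _; rewrite exprS [u ^+ _.+2]exprS mulrACA.
by apply: ler_pM; rewrite ?mulr_ge0 ?vnorm_ge0 ?IHw // ler_wpM2l.
Qed.

(** The central estimate.  The values Y and Z of the letters differ by elements
    of I, equal to V modulo I', and they are equal to P and Q modulo J.
    Replace Z by Y in one letter after the other.  As [I, J] lies in I', the
    letters bracketed with the changed one, which is in I, only matter modulo
    J: the changed letter counts as V and the others as P or Q.  So the
    difference is bounded modulo I' by one factor v, at each of the size w + 1
    positions, and one factor u for every other letter, whatever the sizes of
    Y and Z. *)
Lemma nested_bracket_near (T : Type) (I J I' : {vspace g})
    (Y Z P Q V : T -> g) (u v : R) :
  lie_ideal br I -> lie_ideal br J -> lie_ideal br I' ->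
  (forall x y, x \in I -> y \in J -> br x y \in I') ->
  (forall l, Y l - P l \in J) -> (forall l, Z l - Q l \in J) ->
  (forall l, N (P l) <= u) -> (forall l, N (Q l) <= u) ->
  (forall l, Y l - Z l \in I) -> (forall l, Y l - Z l - V l \in I') ->
  (forall l, N (V l) <= v) ->
  forall l w, near_set N (fun x => x \in I')
    (mu ^+ size w * (size w).+1%:R * v * u ^+ size w)
    (nested_bracket br (Y l) (map Y w) - nested_bracket br (Z l) (map Z w)).
Proof.
move=> Iid Jid I'id IJ YP ZQ Pu Qu YZ YZV Vv l w.
have u0 : 0 <= u by apply: le_trans (Pu l); apply: vnorm_ge0.
have v0 : 0 <= v by apply: le_trans (Vv l); apply: vnorm_ge0.
have I'D s t : s \in I' -> t \in I' -> s + t \in I' by apply: memvD.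
elim: w l => [|k w IHw] l /=.
  exists (Y l - Z l - V l); first exact: YZV.
  by rewrite opprB addrC subrK !mul1r mulr1.
set a := nested_bracket br (Y k) _; set b := nested_bracket br (Z k) _.
set m := size w; pose p := nested_bracket br (P k) (map P w).
rewrite br_diff.
have abI : a - b \in I by apply: nested_bracket_mem.
have apJ : a - p \in J by apply: nested_bracket_mem.
have pu : N p <= mu ^+ m * u ^+ m.+1 by apply: nested_bracket_norm.
have H1 : near_set N (fun x => x \in I') (mu ^+ m.+1 * v * u ^+ m.+1)
    (br (Y l - Z l) a).
  exists (br (Y l - Z l) (a - p) + br (Y l - Z l - V l) p).
    by apply: I'D; [apply: IJ | apply: lie_idealr].
  have -> : br (Y l - Z l) a =
      br (Y l - Z l) (a - p) + br (Y l - Z l - V l) p + br (V l) p.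
    by rewrite -addrA -brDl subrK -brDr subrK.
  rewrite addrC addKr; apply: le_trans (br_bound _ _) _.
  apply: (@le_trans _ _ (mu * v * (mu ^+ m * u ^+ m.+1))).
    by apply: ler_pM; rewrite ?mulr_ge0 ?vnorm_ge0 // ler_wpM2l.
  by rewrite le_eqVlt; apply/orP; left; apply/eqP; rewrite !exprS; ring.
have H2 : near_set N (fun x => x \in I') (mu ^+ m.+1 * m.+1%:R * v * u ^+ m.+1)
    (br (Z l) (a - b)).
  have [s sI' abs] := IHw k.
  exists (br (Z l - Q l) (a - b) + br (Q l) s).
    apply: I'D; last exact: I'id.
    by rewrite brNC memvN; apply: IJ.
  have -> : br (Z l) (a - b) =
      br (Z l - Q l) (a - b) + br (Q l) s + br (Q l) (a - b - s).
    by rewrite -addrA -brDr [s + _]addrC subrK -brDl subrK.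
  rewrite addrC addKr; apply: le_trans (br_bound _ _) _.
  apply: (@le_trans _ _ (mu * u * (mu ^+ m * m.+1%:R * v * u ^+ m))).
    by apply: ler_pM; rewrite ?mulr_ge0 ?vnorm_ge0 // ler_wpM2l.
  by rewrite le_eqVlt; apply/orP; left; apply/eqP; rewrite !exprS; ring.
apply: near_set_mono (near_setD I'D H1 H2).
rewrite le_eqVlt; apply/orP; left; apply/eqP.
by rewrite -[in RHS]natr1 ; ring.
Qed.
End WordDifference.

(** * Words of class A series *)

Section ClassA.
Variables (R : realType) (cplx : bool) (g : vectType (ground_field R cplx)).
Variables (N : vnorm g) (mu : R) (n r : nat).
Variable c : lie_coef (ground_field R cplx) n r.
Hypothesis mu_ge0 : 0 <= mu.
Local Notation K := (ground_field R cplx).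

(** The part of the series of class A that does not depend on the letters. *)
Definition coef_weight (i : 'I_n) (m : nat) : R :=
  \sum_(l : ('I_n + 'I_r)%type) \sum_(w : m.-tuple ('I_n + 'I_r)%type)
    mu ^+ m * modulus (c l w 0 i).

Lemma coef_weight_ge0 i m : 0 <= coef_weight i m.
Proof.
apply: sumr_ge0 => l _; apply: sumr_ge0 => w _.
by rewrite mulr_ge0 ?exprn_ge0 ?modulus_ge0.
Qed.

Lemma nneseries_term_le (a : nat -> R) m : (forall k, 0 <= a k) ->
  (\sum_(0 <= k <oo) (a k)%:E < +oo)%E ->
  a m <= fine (\sum_(0 <= k <oo) (a k)%:E)%E.
Proof.
move=> a0 afin.
have S0 : (0 <= \sum_(0 <= k <oo) (a k)%:E)%E.
  by apply: nneseries_ge0 => k _ _; rewrite lee_fin.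
rewrite -lee_fin fineK ?ge0_fin_numE //.
apply: le_trans (nneseries_lim_ge m.+1 _); last first.
  by move=> k _ _; rewrite lee_fin.
rewrite big_nat_recr //= leeDr //.
by apply: sume_ge0 => k _; rewrite lee_fin.
Qed.

(** The case of one component; the neighbourhood of class A depends on it. *)
Lemma coef_weight_component (y : g) i : 0 < N y -> class_A N mu c ->
  exists C k : R, [/\ 0 <= C, 0 <= k & forall m, coef_weight i m <= C * k ^+ m].
Proof.
move=> y0 cA; have [d d0 dfin] := cA i.
(* All n + r letters get norm rho, with total below d. *)
pose rho := d / (n + r).+1%:R.
have rho0 : 0 < rho by rewrite divr_gt0.
have [b b_y] := @modulus_real R cplx (rho / N y) (divr_ge0 (ltW rho0) (ltW y0)).
have bN : N (b *: y) = rho by rewrite vnormZ b_y divfK // gt_eqF.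
pose X : {ffun 'I_n -> g} := [ffun => b *: y].
pose W : {ffun 'I_r -> g} := [ffun => b *: y].
have lN l : N (letter_val X W l) = rho by case: l => j; rewrite /= ffunE.
have XW : sum_norm N X + sum_norm N W < d.
  rewrite /sum_norm (eq_bigr (fun=> rho)) => [|j _]; last by rewrite ffunE.
  rewrite [X in _ + X](eq_bigr (fun=> rho)) => [|j _]; last by rewrite ffunE.
  rewrite !sumr_const !card_ord -mulrnDr -mulr_natr /rho mulrAC ltr_pdivrMr //.
  by rewrite ltr_pM2l // ltr_nat.
pose a m : R := \sum_(l : ('I_n + 'I_r)%type) \sum_(w : m.-tuple ('I_n + 'I_r)%type)
  mu ^+ m * modulus (c l w 0 i)
    * (N (letter_val X W l) * \prod_(b <- w) N (letter_val X W b)).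
have afin : (\sum_(0 <= m <oo) (a m)%:E < +oo)%E := dfin X W XW.
have aE m : a m = coef_weight i m * rho ^+ m.+1.
  rewrite /a /coef_weight mulr_suml; apply: eq_bigr => l _.
  rewrite mulr_suml; apply: eq_bigr => w _; rewrite lN (eq_bigr (fun=> rho)) //.
  by rewrite big_const_seq count_predT size_tuple iter_mulr mulr1 exprS.
have a0 m : 0 <= a m by rewrite aE mulr_ge0 ?coef_weight_ge0 // exprn_ge0 // ltW.
pose S := fine (\sum_(0 <= m <oo) (a m)%:E)%E.
have aS m : a m <= S by apply: nneseries_term_le.
have S0 : 0 <= S by apply: le_trans (aS 0%N).
exists (S / rho), rho^-1; split=> [||m].
- by rewrite divr_ge0 // ltW.
- by rewrite invr_ge0 ltW.
- by rewrite -mulrA -exprS exprVn ler_pdivlMr ?exprn_gt0 // -aE.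
Qed.

(** Evaluating the series of class A with all letters equal to the same small
    nonzero vector bounds the terms of a power series in the norm of this vector,
    so its coefficients grow at most geometrically. *)
Lemma class_A_geometric (y : g) : 0 < N y -> class_A N mu c ->
  exists C k : R, [/\ 0 <= C, 0 < k &
    forall m, \sum_i coef_weight i m <= C * k ^+ m].
Proof.
move=> y0 cA.
have /choice[Ck CkP] i : exists p : R * R, [/\ 0 <= p.1, 0 <= p.2 &
    forall m, coef_weight i m <= p.1 * p.2 ^+ m].
  by have [C [k Ck]] := coef_weight_component i y0 cA; exists (C, k).
pose k := 1 + \sum_i (Ck i).2.
exists (\sum_i (Ck i).1), k; split=> [||m].
- by apply: sumr_ge0 => i _; case: (CkP i).
- by rewrite ltr_wpDr // sumr_ge0 // => i _; case: (CkP i).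
- rewrite mulr_suml; apply: ler_sum => i _; have [C0 k0 H] := CkP i.
  apply: le_trans (H m) _; rewrite ler_wpM2l // lerXn2r ?nnegrE //.
    by rewrite addr_ge0 // sumr_ge0 // => j _; case: (CkP j).
  rewrite /k (bigD1 i) //= addrCA lerDl addr_ge0 // sumr_ge0 // => j _.
  by case: (CkP j).
Qed.
End ClassA.

Lemma sum_halves_le (R : realFieldType) (D : R) (a : nat -> R) L :
  0 <= D -> a 0%N <= 0 -> (forall m, (0 < m)%N -> a m <= D * 2^-1 ^+ m) ->
  \sum_(m < L) a m <= D.
Proof.
move=> D0 a0 aD; case: L => [|L]; first by rewrite big_ord0.
(* The index 0 is excluded: the remaining halves add up to 1 - 2^-L. *)
apply: (@le_trans _ _ (D * (1 - 2^-1 ^+ L))); last first.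
  by rewrite ler_piMr // lerBlDr lerDl exprn_ge0 // invr_ge0.
elim: L => [|L IHL].
  by rewrite big_ord_recr big_ord0 /= add0r expr0 subrr mulr0.
rewrite big_ord_recr /=; apply: le_trans (lerD IHL (aD _ _)) _ => //.
rewrite -mulrDr ler_wpM2l // exprS.
by set h := _ ^+ L; lra.
Qed.

(** The factor m + 1, the number of positions of a word, is absorbed by
    m + 1 <= 2 ^ m; a quarter of the radius of convergence leaves a ratio 1 / 2. *)
Lemma geometric_word_bound (R : realType) (C k u v b : R) (m : nat) :
  0 <= C -> 0 <= k -> 0 <= u -> 0 <= v -> 4 * k * u <= 1 -> (0 < m)%N ->
  b <= C * k ^+ m ->
  b * (m.+1%:R * v * u ^+ m) <= 4 * C * k * u * v * 2^-1 ^+ m.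
Proof.
move=> C0 k0 u0 v0 ku m0 bC.
have x0 : 0 <= m.+1%:R * v * u ^+ m by rewrite !mulr_ge0 ?exprn_ge0.
apply: le_trans (ler_wpM2r x0 bC) _.
have -> : C * k ^+ m * (m.+1%:R * v * u ^+ m) = C * v * (m.+1%:R * (k * u) ^+ m).
  by rewrite exprMn; ring.
have -> : 4 * C * k * u * v * 2^-1 ^+ m = C * v * (4 * (k * u) * 2^-1 ^+ m) by ring.
apply: ler_wpM2l; first by rewrite mulr_ge0.
have ku0 : 0 <= k * u by rewrite mulr_ge0.
apply: (@le_trans _ _ ((2 * (k * u)) ^+ m)).
  rewrite [leRHS]exprMn ler_wpM2r ?exprn_ge0 // -natrX ler_nat.
  exact: ltn_expl.
case: m m0 {bC x0} => // m _; rewrite !exprS.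
have -> : 4 * (k * u) * (2^-1 * 2^-1 ^+ m) = 2 * (k * u) * 2^-1 ^+ m by field.
rewrite ler_wpM2l ?mulr_ge0 // lerXn2r ?nnegrE ?mulr_ge0 //.
by lra.
Qed.

Section SeriesDifference.
Variables (R : realType) (cplx : bool) (g : vectType (ground_field R cplx)).
Variables (br : lie_bracket g) (N : vnorm g) (mu : R) (n r : nat).
Hypothesis mu_ge0 : 0 <= mu.
Hypothesis br_bound : forall x y : g, N (br x y) <= mu * N x * N y.
Variable c : lie_coef (ground_field R cplx) n r.
Hypothesis c_state : forall j, c (inl j) [::] = 0.
Variables C k : R.
Hypotheses (C_ge0 : 0 <= C) (k_gt0 : 0 < k).
Hypothesis weight_le : forall m, \sum_i coef_weight mu c i m <= C * k ^+ m.
Local Notation letters := ('I_n + 'I_r)%type.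

(** Words of length 1 contribute nothing: state letters have coefficient 0 and
    signal letters take the same value at X and X0.  All other words have at
    least one letter besides the changed one, whence the factor u. *)
Lemma partial_sum_near (I J I' : {vspace g})
    (X X0 : {ffun 'I_n -> g}) (W : {ffun 'I_r -> g})
    (P Q V : letters -> g) (u v : R) (L : nat) :
  lie_ideal br I -> lie_ideal br J -> lie_ideal br I' ->
  (forall x y, x \in I -> y \in J -> br x y \in I') ->
  (forall l, letter_val X W l - P l \in J) ->
  (forall l, letter_val X0 W l - Q l \in J) ->
  (forall l, N (P l) <= u) -> (forall l, N (Q l) <= u) ->
  (forall l, letter_val X W l - letter_val X0 W l \in I) ->
  (forall l, letter_val X W l - letter_val X0 W l - V l \in I') ->
  (forall l, N (V l) <= v) ->
  0 <= u -> 0 <= v -> 4 * k * u <= 1 ->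
  near_set (sum_vnorm N n) (in_power I') (4 * C * k * u * v)
    (lie_partial_sum br c L X W - lie_partial_sum br c L X0 W).
Proof.
move=> Iid Jid I'id IJ YP ZQ Pu Qu YZ YZV Vv u0 v0 ku.
pose a i m := if m is _.+1 then coef_weight mu c i m * (m.+1%:R * v * u ^+ m) else 0.
apply: (@near_set_mono _ _ _ _ _ (\sum_(i < n) \sum_(m < L) a i m)).
  rewrite exchange_big /=.
  apply: (@sum_halves_le _ _ (fun m => \sum_i a i m)) => [||m m0].
  - by rewrite !mulr_ge0 // ltW.
  - by rewrite big1.
  - rewrite (eq_bigr (fun i => coef_weight mu c i m * (m.+1%:R * v * u ^+ m))).
      by rewrite -mulr_suml; apply: geometric_word_bound => //; apply: ltW.
    by case: m m0.
apply: near_power => i; rewrite !ffunE -sumrB.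
have I'D s t : s \in I' -> t \in I' -> s + t \in I' by apply: memvD.
apply: near_set_sum => [|//|m]; first exact: mem0v.
rewrite -sumrB.
have aE : a i m = \sum_(l : letters) \sum_(w : m.-tuple letters)
    (if nat_of_ord m is 0%N then 0 else
      mu ^+ m * modulus (c l w 0 i) * (m.+1%:R * v * u ^+ m)).
  rewrite /a; case: (nat_of_ord m) => [|m'].
    by rewrite big1 // => l _; rewrite big1.
  by rewrite /coef_weight mulr_suml; apply: eq_bigr => l _; rewrite mulr_suml.
rewrite aE.
apply: near_set_sum => [|//|l]; first exact: mem0v.
rewrite -sumrB.
apply: near_set_sum => [|//|w]; first exact: mem0v.
rewrite -scalerBr /word_val.
have := nested_bracket_near mu_ge0 br_bound Iid Jid I'id IJ YP ZQ Pu Qu YZ YZV Vv l w.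
move: w; case: (nat_of_ord m) => [|m'] w.
  case: l => j; rewrite (tuple0 w) /=.
    by rewrite c_state mxE scale0r => _; apply: near_set_mem; rewrite mem0v.
  by rewrite subrr scaler0 => _; apply: near_set_mem; rewrite mem0v.
move=> /(near_setZ (k := c l w 0 i)) H.
apply: near_set_mono (H _); last by move=> s; apply: memvZ.
by rewrite size_tuple le_eqVlt; apply/orP; left; apply/eqP; ring.
Qed.

(** Words with a letter in an ideal lie in it, and the words without state
    letters cancel. *)
Lemma partial_sum_mem (I : {vspace g}) (X : {ffun 'I_n -> g})
    (W : {ffun 'I_r -> g}) L : lie_ideal br I ->
  in_power I X ->
  in_power I (lie_partial_sum br c L X W - lie_partial_sum br c L 0 W).
Proof.
move=> Iid XI i; rewrite !ffunE -sumrB; apply: memv_suml => m _.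
rewrite -sumrB; apply: memv_suml => l _; rewrite -sumrB; apply: memv_suml => w _.
rewrite -scalerBr memvZ //; apply: nested_bracket_mem => // -[j|j] /=.
  by rewrite ffunE subr0.
by rewrite subrr mem0v.
Qed.
End SeriesDifference.

(** * The dynamics *)

Lemma cvg0_eventually (R : realType) (u : nat -> R) (e : R) :
  u k @[k --> \oo] --> (0 : R) -> 0 < e ->
  exists k0, forall k, (k0 <= k)%N -> u k < e.
Proof.
move=> /cvgrPdist_lt u0 /u0[k0 _ ku]; exists k0 => k /ku /=.
by rewrite sub0r normrN; apply: le_lt_trans; apply: ler_norm.
Qed.

Lemma small_scale (R : realFieldType) (s : seq R) :
  exists2 u : R, 0 < u & forall x, x \in s -> x * u <= 1.
Proof.
pose S := 1 + \sum_(y <- s) `|y|.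
have S0 : 0 < S by rewrite ltr_wpDr // sumr_ge0.
exists S^-1 => [|x xs]; first by rewrite invr_gt0.
rewrite ler_pdivrMr // mul1r /S (big_rem _ xs) /=.
apply: le_trans (ler_norm x) _; rewrite addrCA lerDl addr_ge0 //.
exact: sumr_ge0.
Qed.

Section Dynamics.
Variables (R : realType) (cplx : bool) (g : vectType (ground_field R cplx)).
Variables (br : lie_bracket g) (N : vnorm g) (mu : R) (n r : nat).
Hypothesis mu_ge0 : 0 <= mu.
Hypothesis br_bound : forall x y : g, N (br x y) <= mu * N x * N y.
Variables (f : {ffun 'I_n -> g} -> {ffun 'I_r -> g} -> {ffun 'I_n -> g}).
Variables (A : 'End({ffun 'I_n -> g})) (c : lie_coef (ground_field R cplx) n r).
Hypothesis f_lie : lie_function N br A c f.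
Hypothesis f0 : forall W, f 0 W = 0.
Variables C k : R.
Hypotheses (C_ge0 : 0 <= C) (k_gt0 : 0 < k).
Hypothesis weight_le : forall m, \sum_i coef_weight mu c i m <= C * k ^+ m.
Variables (P : vnorm {ffun 'I_n -> g}) (q kappa : R).
Hypotheses (q_ge0 : 0 <= q) (q_lt1 : q < 1) (kappa_gt0 : 0 < kappa).
Hypothesis P_contract : forall X, P (A X) <= q * P X.
Hypothesis N_le_P : forall X, sum_norm N X <= P X.
Hypothesis P_le_N : forall X, P X <= kappa * sum_norm N X.
Local Notation letters := ('I_n + 'I_r)%type.
Implicit Types (X : {ffun 'I_n -> g}) (W : {ffun 'I_r -> g}).

Definition higher_order X W := f X W - A X.

Lemma higher_order_approx X0 X W (e : R) : 0 < e ->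
  exists L, sum_norm N (higher_order X W - higher_order X0 W
    - (lie_partial_sum br c L X W - lie_partial_sum br c L X0 W)) <= e.
Proof.
move=> e0; have e2 : 0 < e / 2 by rewrite divr_gt0.
have [L1 H1] := cvg0_eventually (f_lie.2 X W) e2.
have [L2 H2] := cvg0_eventually (f_lie.2 X0 W) e2.
exists (maxn L1 L2); have := H1 _ (leq_maxl L1 L2).
have := H2 _ (leq_maxr L1 L2); move: (maxn _ _) => L.
set p0 := lie_partial_sum _ _ _ X0 _; set p := lie_partial_sum _ _ _ X _.
move=> E0 E1.
have -> : higher_order X W - higher_order X0 W - (p - p0) =
    (A X0 + p0 - f X0 W) - (A X + p - f X W).
  have E Y y : A Y + y - f Y W = y - higher_order Y W.
    by rewrite /higher_order opprB addrA [y + _]addrC.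
  by rewrite !E !opprB addrACA [RHS]addrACA [p0 + _]addrC.
apply: le_trans (vnormD (sum_vnorm N n) _ _) _; rewrite vnormN /=.
by move: E0 E1; lra.
Qed.

Lemma near_set_P (S : {ffun 'I_n -> g} -> Prop) a X :
  near_set (sum_vnorm N n) S a X -> near_set P S (kappa * a) X.
Proof.
move=> [s Ss sX]; exists s => //; apply: le_trans (P_le_N _) _.
by rewrite ler_pM2l.
Qed.

(** [nested_bracket_near] summed over all words.  The series is only known to
    converge at the two points, not absolutely, so the bound is passed to the
    limit through the partial sums, at the cost of e. *)
Lemma higher_order_near (I J I' : {vspace g}) X X0 W
    (Pl Ql Vl : letters -> g) (u v e : R) :
  lie_ideal br I -> lie_ideal br J -> lie_ideal br I' ->
  (forall x y, x \in I -> y \in J -> br x y \in I') ->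
  (forall l, letter_val X W l - Pl l \in J) ->
  (forall l, letter_val X0 W l - Ql l \in J) ->
  (forall l, N (Pl l) <= u) -> (forall l, N (Ql l) <= u) ->
  (forall l, letter_val X W l - letter_val X0 W l \in I) ->
  (forall l, letter_val X W l - letter_val X0 W l - Vl l \in I') ->
  (forall l, N (Vl l) <= v) ->
  0 <= u -> 0 <= v -> 4 * k * u <= 1 -> 0 < e ->
  near_set (sum_vnorm N n) (in_power I') (4 * C * k * u * v + e)
    (higher_order X W - higher_order X0 W).
Proof.
move=> Iid Jid I'id IJ YP ZQ Pu Qu YZ YZV Vv u0 v0 ku e0.
have [L HL] := higher_order_approx X0 X W e0.
have HP := partial_sum_near mu_ge0 br_bound f_lie.1 C_ge0 k_gt0 weight_le
  L Iid Jid I'id IJ YP ZQ Pu Qu YZ YZV Vv u0 v0 ku.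
rewrite -[_ - _](subrK (lie_partial_sum br c L X W - lie_partial_sum br c L X0 W)).
rewrite [X in near_set _ _ _ X]addrC; apply: (near_setD _ HP); first exact: in_powerD.
apply: near_set_mono HL _; apply: near_set_norm; exact: in_power0.
Qed.

(** The higher-order part is the limit of the vectors of I^n that
    [partial_sum_mem] provides. *)
Lemma higher_order_mem_near (I : {vspace g}) X W (e : R) :
  lie_ideal br I -> in_power I X -> 0 < e ->
  near_set (sum_vnorm N n) (in_power I) e (higher_order X W).
Proof.
move=> Iid XI e0; have [L HL] := higher_order_approx 0 X W e0.
exists (lie_partial_sum br c L X W - lie_partial_sum br c L 0 W).
  exact: partial_sum_mem.
by move: HL; rewrite {2}/higher_order f0 linear0 subrr subr0.
Qed.

(** The case I = g, J = I' = 0 of [higher_order_near], at X0 = 0: there every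
    letter counts with its full value, and the changed ones are those of X. *)
Lemma higher_order_small X W (u : R) :
  sum_norm N X + sum_norm N W <= u -> 4 * k * u <= 1 ->
  sum_norm N (higher_order X W) <= 4 * C * k * u * sum_norm N X.
Proof.
move=> XWu ku; have X0 := vnorm_ge0 (sum_vnorm N n) X.
have W0 := vnorm_ge0 (sum_vnorm N r) W.
have u0 : 0 <= u by move: XWu X0 W0 => /=; lra.
apply/ler_addgt0Pr => e e0.
have XN j : N (X j) <= u.
  by apply: le_trans (sum_norm_ge N j X) _; move: XWu W0 => /=; lra.
have WN j : N (W j) <= u.
  by apply: le_trans (sum_norm_ge N j W) _; move: XWu X0 => /=; lra.
have N0 : N 0 <= u by rewrite vnorm0.
have [||||||||||||s s0 H] := @higher_order_near fullv 0%VS 0%VS X 0 W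
  (letter_val X W) (letter_val 0 W) (letter_val X 0) u (sum_norm N X) e
  (@lie_idealf _ _ _) (@lie_ideal0 _ _ _) (@lie_ideal0 _ _ _).
- by move=> x y _; rewrite memv0 => /eqP ->; rewrite br0r mem0v.
- by move=> l; rewrite subrr mem0v.
- by move=> l; rewrite subrr mem0v.
- by case=> j /=.
- by case=> j /=; rewrite ?ffunE.
- by move=> l; rewrite memvf.
- by case=> j /=; rewrite !ffunE ?subr0 subrr ?subrr mem0v.
- case=> j /=; first exact: sum_norm_ge.
  by rewrite ffunE vnorm0.
- by [].
- exact: X0.
- by [].
- by [].
have s00 : s = 0 by apply/ffunP => j; apply/eqP; rewrite ffunE -memv0.
move: H; rewrite s00 subr0 [X in _ - X](_ : _ = 0) ?subr0 //.
by rewrite /higher_order f0 linear0 subrr.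
Qed.

(** X = U + Y with U small and Y in I^n, and X = Q + s with s in I'^n: then
    X - U equals Q - U modulo I', a vector whose norm is controlled by the
    distance a from X to I'^n and not by the size of X. *)
Lemma step_near (I J I' h : {vspace g}) X W (u beta a : R) :
  lie_ideal br I -> lie_ideal br J -> lie_ideal br I' ->
  (forall x y, x \in I -> y \in J -> br x y \in I') ->
  (I <= J)%VS -> (h <= J)%VS ->
  (forall X, in_power I' X -> in_power I' (f X W)) ->
  0 < u -> u <= 1 -> 0 <= beta -> 4 * k * (u + beta) <= 1 ->
  near_set P (in_power I) u X ->
  near_set (sum_vnorm N r) (in_power h) u W -> sum_norm N W <= beta ->
  near_set P (in_power I') a X ->
  near_set P (in_power I')
    ((q + kappa * (4 * C * k) * u) * a
      + (2 * kappa + kappa * (4 * C * k) * (2 + beta)) * u) (f X W).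
Proof.
move=> Iid Jid I'id IJ sIJ shJ fI' u0 u1 beta0 kub [Y YI YX] [Z Zh ZW] Wb [s sI' sX].
pose D := kappa * (4 * C * k).
have [U UE] : exists U, U = X - Y by exists (X - Y).
have [Q QE] : exists Q, Q = X - s by exists (X - s).
have [W' WE] : exists W', W' = W - Z by exists (W - Z).
have XU j : X j = Y j + U j by rewrite UE !ffunE addrC subrK.
have XQ j : X j = s j + Q j by rewrite QE !ffunE addrC subrK.
have WW j : W j = Z j + W' j by rewrite WE !ffunE addrC subrK.
have a0 : 0 <= a by apply: le_trans sX; apply: vnorm_ge0.
have D0 : 0 <= D by rewrite !mulr_ge0 // ltW.
have u0' := ltW u0.
have UP : P U <= u by rewrite UE.
have QP : P Q <= a by rewrite QE.
have WN : sum_norm N W' <= u by rewrite WE.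
have UN : sum_norm N U <= u by apply: le_trans (N_le_P _) UP.
have ku : 4 * k * u <= 1.
  by apply: le_trans kub; rewrite ler_wpM2l ?lerDl // mulr_ge0 // ltW.
(* A s is the difference of f s W, which is in I'^n, and of the higher-order
   part at s, which is near I'^n. *)
have HAs : near_set P (in_power I') (kappa * u) (A s).
  have [t tI' tH] := higher_order_mem_near W I'id sI' u0.
  exists (f s W - t); first by apply: in_powerB => //; apply: fI'.
  rewrite -vnormN; apply: le_trans (P_le_N _) _; rewrite ler_pM2l //.
  have -> : - (A s - (f s W - t)) = higher_order s W - t by rewrite opprB addrAC.
  by [].
have HAQ : near_set P (in_power I') (q * a) (A Q).
  apply: near_set_mono (near_set_norm _ _ _); last exact: in_power0.
  by apply: le_trans (P_contract _) _; rewrite ler_wpM2l.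
have HU : near_set P (in_power I') (D * (u + beta) * u) (higher_order U W).
  apply: near_set_mono (near_set_norm _ _ _); last exact: in_power0.
  apply: le_trans (P_le_N _) _; rewrite /D -2!mulrA ler_pM2l //.
  apply: le_trans (higher_order_small (u := u + beta) _ _) _ => //.
    exact: lerD.
  rewrite mulrA ler_wpM2l // !mulr_ge0 // ?addr_ge0 //; exact: ltW.
have HXU : near_set P (in_power I') (D * u * (a + u) + kappa * u)
    (higher_order X W - higher_order U W).
  apply: near_set_mono (near_set_P (@higher_order_near I J I' X U W
    (letter_val U W') (letter_val U W') (letter_val (Q - U) 0) u (a + u) u
    Iid Jid I'id IJ _ _ _ _ _ _ _ u0' (addr_ge0 a0 u0') ku u0)).
  - by rewrite /D le_eqVlt; apply/orP; left; apply/eqP; ring.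
  - by case=> j /=; rewrite ?XU ?WW addrK; [apply: (subvP sIJ) | apply: (subvP shJ)].
  - by case=> j /=; rewrite ?subrr ?mem0v // WW addrK; apply: (subvP shJ).
  - case=> j; first exact: le_trans (sum_norm_ge _ _ _) UN.
    exact: le_trans (sum_norm_ge _ _ _) WN.
  - case=> j; first exact: le_trans (sum_norm_ge _ _ _) UN.
    exact: le_trans (sum_norm_ge _ _ _) WN.
  - by case=> j /=; rewrite ?subrr ?mem0v // XU addrK.
  - case=> j /=; last by rewrite ffunE subrr subr0 mem0v.
    have -> : (Q - U) j = Q j - U j by rewrite !ffunE.
    by rewrite opprB addrA subrK XQ addrK.
  - case=> j /=; last by rewrite ffunE vnorm0 addr_ge0.
    apply: le_trans (sum_norm_ge N j (Q - U)) _.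
    apply: le_trans (N_le_P _) _; apply: le_trans (vnormD _ _ _) _.
    by rewrite vnormN lerD.
have -> : f X W = A Q + A s + (higher_order X W - higher_order U W)
    + higher_order U W.
  by rewrite -linearD {1}QE subrK -addrA subrK /higher_order addrC subrK.
apply: near_set_mono (near_setD _ (near_setD _ (near_setD _ HAQ HAs) HXU) HU);
  try exact: in_powerD.
rewrite -/D.
have -> : q * a + kappa * u + (D * u * (a + u) + kappa * u) + D * (u + beta) * u =
  (q + D * u) * a + (kappa + kappa + D * (u + u + beta)) * u by ring.
rewrite lerD2l ler_wpM2r //; apply: lerD; first by lra.
by rewrite ler_wpM2l //; lra.
Qed.

(** The nonlinear part is at most (1 - q) P X, which is what the contraction
    by A leaves. *)
Lemma step_contract X W (beta : R) : 0 <= beta ->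
  4 * k * (2 * beta) <= 1 -> kappa * (4 * C * k) * (2 * beta) <= 1 - q ->
  sum_norm N W <= beta -> P X <= beta -> P (f X W) <= P X.
Proof.
move=> beta0 kb Db Wb Xb.
have -> : f X W = A X + higher_order X W by rewrite /higher_order addrC subrK.
have XWb : sum_norm N X + sum_norm N W <= 2 * beta.
  by have := N_le_P X; lra.
have H := higher_order_small XWb kb.
apply: le_trans (vnormD _ _ _) _.
apply: (@le_trans _ _ (q * P X + (1 - q) * P X)); last first.
  by rewrite -mulrDl addrC subrK mul1r.
apply: lerD => //; apply: le_trans (P_le_N _) _.
apply: (@le_trans _ _ (kappa * (4 * C * k) * (2 * beta) * sum_norm N X)).
  apply: (le_trans (ler_wpM2l (ltW kappa_gt0) H)).
  by rewrite le_eqVlt; apply/orP; left; apply/eqP; ring.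
apply: ler_pM => //; last exact: (vnorm_ge0 (sum_vnorm N n)).
by rewrite !mulr_ge0 // ltW.
Qed.

(** For u small, [step_near] gives the recursion a' <= p a + (1 - p) e / 2 with
    p < 1 for the distance to I'^n, once X is u-close to I^n and W to h^r. *)
Lemma attract_step (I J I' h : {vspace g}) (beta : R) (W : nat -> {ffun 'I_r -> g})
    (X : nat -> {ffun 'I_n -> g}) :
  lie_ideal br I -> lie_ideal br J -> lie_ideal br I' ->
  (forall x y, x \in I -> y \in J -> br x y \in I') ->
  (I <= J)%VS -> (h <= J)%VS ->
  (forall X W, in_power I' X -> in_power I' (f X W)) ->
  0 <= beta -> 4 * k * (2 * beta) <= 1 ->
  (forall u, 0 < u -> exists k0, forall j, (k0 <= j)%N ->
    near_set (sum_vnorm N r) (in_power h) u (W j)) ->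
  (forall j, sum_norm N (W j) <= beta) ->
  trajectory f W X ->
  (forall u, 0 < u -> exists k0, forall j, (k0 <= j)%N ->
    near_set P (in_power I) u (X j)) ->
  forall u, 0 < u -> exists k0, forall j, (k0 <= j)%N ->
    near_set P (in_power I') u (X j).
Proof.
move=> Iid Jid I'id IJ sIJ shJ fI' beta0 kb Wh Wb Xt XI e e0.
pose D := kappa * (4 * C * k); pose c2 := 2 * kappa + D * (2 + beta).
have q1 : 0 < 1 - q by rewrite subr_gt0.
(* The conditions on u: the word estimates for letters bounded by u + beta;
   q + D u <= p; and an inhomogeneous term c2 u of at most (1 - p) e / 2. *)
have [u u0 su] := small_scale
  [:: 1; 8 * k; 2 * D / (1 - q); 4 * c2 / (e * (1 - q))].
have u1 : u <= 1 by have := su 1; rewrite mul1r; apply; rewrite !inE eqxx.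
have u2 : 8 * k * u <= 1 by apply: su; rewrite !inE eqxx ?orbT.
have u3 : 2 * D / (1 - q) * u <= 1 by apply: su; rewrite !inE eqxx ?orbT.
have u4 : 4 * c2 / (e * (1 - q)) * u <= 1 by apply: su; rewrite !inE eqxx ?orbT.
have [k1 H1] := Wh u u0; have [k2 H2] := XI u u0.
pose k0 := maxn k1 k2; pose p := (1 + q) / 2.
have p0 : 0 <= p by rewrite divr_ge0 // addr_ge0.
have p1 : p < 1 by rewrite /p; lra.
have up : q + D * u <= p.
  by move: u3; rewrite mulrAC ler_pdivrMr // /p mul1r; lra.
have ue : c2 * u <= (1 - p) * (e / 2).
  move: u4; rewrite mulrAC ler_pdivrMr ?mulr_gt0 // /p mul1r; lra.
pose a0 := P (X k0).
have a00 : 0 <= a0 by apply: vnorm_ge0.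
have near_j j : near_set P (in_power I') (p ^+ j * a0 + e / 2) (X (k0 + j)%N).
  elim: j => [|j IHj].
    rewrite addn0 expr0 mul1r; have e1 : a0 <= a0 + e / 2 by lra.
    by apply: (near_set_mono e1); apply: near_set_norm; apply: in_power0.
  rewrite addnS Xt.
  have kj : (k0 <= k0 + j)%N by rewrite leq_addr.
  have k1j : (k1 <= k0 + j)%N by apply: leq_trans kj; rewrite leq_maxl.
  have k2j : (k2 <= k0 + j)%N by apply: leq_trans kj; rewrite leq_maxr.
  have kub : 4 * k * (u + beta) <= 1 by move: u2 kb; rewrite mulrDr; lra.
  have := step_near Iid Jid I'id IJ sIJ shJ (fun X => @fI' X (W (k0 + j)%N)) u0 u1
    beta0 kub (H2 _ k2j) (H1 _ k1j) (Wb _) IHj.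
  apply: near_set_mono; rewrite -/D -/c2.
  set a := p ^+ j * a0 + e / 2.
  have a_ge0 : 0 <= a by apply: near_set_ge0 IHj.
  apply: le_trans (lerD (ler_wpM2r a_ge0 up) ue) _.
  rewrite /a exprS le_eqVlt; apply/orP; left; apply/eqP; ring.
have [j0 Hj0] : exists j0, forall j, (j0 <= j)%N -> p ^+ j * a0 < e / 2.
  apply: cvg0_eventually; last by rewrite divr_gt0.
  rewrite -(mul0r a0); apply: cvgMl; apply: cvg_expr.
  by rewrite ger0_norm.
exists (k0 + j0)%N => j jk.
have kj : (k0 <= j)%N by apply: leq_trans jk; rewrite leq_addr.
rewrite -(subnKC kj); apply: near_set_mono (near_j _).
have := Hj0 (j - k0)%N; rewrite leq_subRL // => /(_ jk); lra.
Qed.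
End Dynamics.

Lemma dist_power_near (R : realType) (cplx : bool)
    (g : vectType (ground_field R cplx)) (N : vnorm g) (m : nat)
    (U : {vspace g}) (X : {ffun 'I_m -> g}) (u : R) :
  dist_power N U X < u -> near_set (sum_vnorm N m) (in_power U) u X.
Proof.
move=> /inf_lt[|_ [Y YU <-] XY]; last by exists Y => //; apply: ltW.
by exists (sum_norm N (X - 0)), 0 => //; apply: in_power0.
Qed.

(** * Global asymptotic stability *)

Unset Implicit Arguments.

Theorem corollary5p4 (R : realType) (cplx : bool)
    (g : vectType (ground_field R cplx)) (br : lie_bracket g) (N : vnorm g)
    (mu : R) (mu_ge0 : 0 <= mu) (mu_le2 : mu <= 2)
    (br_bound : forall x y : g, N (br x y) <= mu * N x * N y)
    (g_solvable : solvable_lie br)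
    (n r : nat) (n_gt0 : (0 < n)%N) (r_gt0 : (0 < r)%N)
    (f : {ffun 'I_n -> g} -> {ffun 'I_r -> g} -> {ffun 'I_n -> g})
    (A : 'End({ffun 'I_n -> g})) (c : lie_coef (ground_field R cplx) n r)
    (f_lie : lie_function N br A c f)
    (f_class_A : class_A N mu c)
    (f_equilibrium : forall X, (forall W, f X W = X) <-> X = 0)
    (h : {vspace g}) (h_ideal : lie_ideal br h)
    (h_nilpotent : nilpotent_space br h)
    (h_derived : (comm_space br fullv fullv <= h)%VS)
    (f_invariant : forall i X W, in_power (lower_central br h i) X ->
       in_power (lower_central br h i) (f X W))
    (A_schur : schur A) :
  exists2 beta : R, 0 < beta &
    forall W : nat -> {ffun 'I_r -> g},
      dist_power N h (W k) @[k --> \oo] --> (0 : R) ->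
      (forall k, sum_norm N (W k) <= beta) ->
      globally_asymptotically_stable N f W.
Proof.
(* Class A bounds the coefficients only if some letter is nonzero. *)
have [[y y0]|g0] := pselect (exists y, 0 < N y); last first.
  have sum0 X : sum_norm N X = 0 :> R.
    rewrite /sum_norm big1 // => j _; apply/eqP; rewrite eq_le vnorm_ge0 andbT.
    by rewrite leNgt; apply/negP => Xj; apply: g0; exists (X j).
  exists 1 => // W _ _; split=> [e e0|X _].
    by exists 1 => // X _ _ k; rewrite sum0.
  by under eq_fun do rewrite sum0; apply: cvg_cst.
have [C [k [C0 k0 Ck]]] := class_A_geometric mu_ge0 y0 f_class_A.
have [P [q [kappa [/andP[q0 q1] kappa0 PA NP PN]]]] :=
  schur_adapted_norm (sum_vnorm N n) A_schur.
have f0 W : f 0 W = 0 by exact: (iffRL (f_equilibrium 0) erefl W).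
pose D := kappa * (4 * C * k).
have q1' : 0 < 1 - q by rewrite subr_gt0.
(* The word estimates hold for letters bounded by 2 beta, and the nonlinear
   part there is dominated by the margin 1 - q. *)
have [beta beta0 sbeta] := small_scale [:: 8 * k; 2 * D / (1 - q)].
have kb : 4 * k * (2 * beta) <= 1.
  have := sbeta (8 * k); rewrite inE eqxx => /(_ isT); lra.
have Db : D * (2 * beta) <= 1 - q.
  have := sbeta (2 * D / (1 - q)); rewrite !inE eqxx orbT => /(_ isT).
  by rewrite mulrAC ler_pdivrMr // mul1r; lra.
exists beta => // W Wh Wb.
have Wnear u : 0 < u -> exists k1, forall j, (k1 <= j)%N ->
    near_set (sum_vnorm N r) (in_power h) u (W j).
  move=> u0; have [k1 H] := cvg0_eventually Wh u0; exists k1 => j /H.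
  exact: dist_power_near.
have chain i X : trajectory f W X -> forall u, 0 < u ->
    exists k1, forall j, (k1 <= j)%N ->
      near_set P (in_power (lower_central br h i)) u (X j).
  move=> Xt; elim: i => [|i IHi].
    apply: (attract_step mu_ge0 br_bound f_lie f0 C0 k0 Ck q0 q1 kappa0 PA NP PN
      (@lie_idealf _ _ br) (@lie_idealf _ _ br) h_ideal _ _ (subvf h)
      (fun X W => @f_invariant 0%N X W) (ltW beta0) kb Wnear Wb Xt).
    - move=> x z _ _; apply: (subvP h_derived).
      by apply: mem_comm_space; rewrite memvf.
    - exact: subvv.
    - move=> u u0; exists 0%N => j _; apply: (near_set_mono (ltW u0)).
      by apply: near_set_mem => l; rewrite memvf.
  have sIh : (lower_central br h i <= h)%VS.
    case: (i) => [|i']; first exact: subvv.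
    by apply/comm_spaceP => x z _ zh; apply: h_ideal.
  exact: (attract_step mu_ge0 br_bound f_lie f0 C0 k0 Ck q0 q1 kappa0 PA NP PN
    (lie_ideal_lower_central (i := i) h_ideal) h_ideal
    (lie_ideal_lower_central (i := i.+1) h_ideal)
    (@mem_comm_space _ _ br _ _) sIh (subvv h)
    (fun X W => @f_invariant i.+1 X W) (ltW beta0) kb Wnear Wb Xt IHi).
split=> [e e0|X Xt].
  exists (Num.min beta e / kappa) => [|X Xt X0 j].
    by rewrite divr_gt0 // lt_min beta0.
  move: X0; rewrite ltr_pdivlMr // mulrC => /(le_lt_trans (PN _)).
  rewrite lt_min => /andP[/ltW X0b X0e].
  apply: le_lt_trans (NP _) (le_lt_trans _ X0e).
  elim: j => // j IHj; rewrite Xt; apply: le_trans (IHj).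
  exact: (step_contract mu_ge0 br_bound f_lie f0 C0 k0 Ck kappa0 PA NP PN
    (ltW beta0) kb Db (Wb j) (le_trans IHj X0b)).
have [p p0] := h_nilpotent.
apply/cvgrPdist_lt => e e0.
have e2 : 0 < e / 2 by rewrite divr_gt0.
have [k1 Hk] := chain p X Xt (e / 2) e2.
exists k1 => // j /Hk; rewrite p0 => -[s s0] /= sX.
have s00 : s = 0 by apply/ffunP => l; apply/eqP; rewrite ffunE -memv0.
rewrite sub0r normrN ger0_norm; last exact: (vnorm_ge0 (sum_vnorm N n)).
by move: sX; rewrite s00 subr0; have := NP (X j) => /=; lra.
Qed.
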